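(* Let $s\ge 1$ and $\Delta\ge 1$ be integers. Let $G$ be a multipartite graph with a partition $\mathcal{P}=(V_1,V_2,\ldots,V_r)$. If $\Delta(G)\le \Delta$ and $\mathcal{P}$ is $2s^2\Delta$-thick, then $G$ has an independent transversal blow-up of size $s$ with respect to $\mathcal{P}$.
   Context: All graphs are finite and simple; $\Delta(G)$ denotes the maximum degree of $G$. A multipartite graph $G$ with partition $\mathcal{P}=(V_1,\ldots,V_r)$ is a graph whose vertex set is the disjoint union of the blocks $V_1,\ldots,V_r$, each of which is an independent set of $G$. The partition $\mathcal{P}$ is $x$-thick if $|V_i|\ge x$ for every $i\in[r]$. An independent transversal blow-up of size $s$ with respect to $\mathcal{P}$ is an independent set of $G$ containing exactly $s$ vertices from each block $V_i$. *)

(* Defs.v *)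
From mathcomp Require Import all_boot.

Set Implicit Arguments.
Unset Strict Implicit.
Unset Printing Implicit Defensive.

Record sgraph (T : finType) := SGraph {
  adj :> rel T;
  adj_sym : symmetric adj;
  adj_irr : irreflexive adj
}.

Definition nbh (T : finType) (G : sgraph T) (v : T) : {set T} :=
  [set w | G v w].

Definition max_degree (T : finType) (G : sgraph T) : nat :=
  \max_(v : T) #|nbh G v|.

Definition independent (T : finType) (G : sgraph T) (A : {set T}) : Prop :=
  {in A &, forall u v, ~~ G u v}.

(* Disjointness is stated on indices, so that two distinct indices may not
   carry the same nonempty block.  Empty blocks are not excluded. *)
Definition multipartite (T : finType) (G : sgraph T) (r : nat)
    (V : 'I_r -> {set T}) : Prop :=
  [/\ \bigcup_(i < r) V i = [set: T],
      forall i j : 'I_r, i != j -> [disjoint V i & V j]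
    & forall i : 'I_r, independent G (V i)].

Definition thick (T : finType) (r : nat) (V : 'I_r -> {set T}) (x : nat) : Prop :=
  forall i : 'I_r, x <= #|V i|.

Definition transversal_blowup (T : finType) (G : sgraph T) (r : nat)
    (V : 'I_r -> {set T}) (s : nat) (S : {set T}) : Prop :=
  independent G S /\ forall i : 'I_r, #|S :&: V i| = s.

(* Main.v *)
Require Import Defs.
From mathcomp Require Import all_boot zify.

Set Implicit Arguments.
Unset Strict Implicit.
Unset Printing Implicit Defensive.

(** Cut each block into [s] pieces of size at least [2 * Delta] and apply
    Haxell's independent transversal theorem to all the pieces at once.

    Haxell's theorem follows from a deficiency version: if an independent
    transversal of all blocks but one, [a], cannot be replaced by a full one,
    then some family [J] of blocks containing [a] is totally dominated by at
    most [2 * (#|J| - 1)] vertices; with blocks of size [2 * Delta] this is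
    impossible by counting.  The deficiency version is proved by deleting edges
    from a vertex [w] of block [a] until deleting the edge [w y] creates a
    transversal.  This transversal contains [w] and [y]; one then discards the
    neighbours of [w] and [y], merges the blocks of [w] and [y], and applies
    induction: a transversal of the merged system, together with [w] or [y],
    would be one of the original system. *)

(** Values of [f] outside [L] are arbitrary, so partial and full transversals share one type. *)
Definition indep_transversal (T K : finType) (e : rel T) (P : K -> {set T})
    (L : {set K}) (f : K -> T) : Prop :=
  (forall i, i \in L -> f i \in P i) /\
  (forall i j, i \in L -> j \in L -> i != j -> ~~ e (f i) (f j)).

Definition totally_dominates (T : finType) (e : rel T) (Z A : {set T}) : Prop :=
  forall v, v \in A -> exists2 z, z \in Z & e z v.

Definition del_edge (T : finType) (e : rel T) (w y : T) : rel T :=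
  fun u v => e u v && ~~ ((u == w) && (v == y) || (u == y) && (v == w)).

(** Index [b] is kept with an empty block, so that the induction never changes the index type. *)
Definition merge_blocks (T K : finType) (e : rel T) (P : K -> {set T})
    (a b : K) (w y : T) : K -> {set T} :=
  fun i => [set v in (if i == b then set0
                      else if i == a then P a :|: P b else P i)
           | ~~ e w v && ~~ e y v].

Lemma indep_transversal_extend (T K : finType) (e : rel T) (P : K -> {set T})
    (L : {set K}) (a : K) (w : T) (f : K -> T) :
  symmetric e -> w \in P a -> indep_transversal e P (L :\ a) f ->
  (forall i, i \in L :\ a -> ~~ e w (f i)) ->
  indep_transversal e P L (fun i => if i == a then w else f i).
Proof.
move=> esym wa [fP fe] wf; split=> [i iL | i j iL jL ij].
  by case: eqP => [-> // | /eqP ia]; apply: fP; rewrite in_setD1 ia.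
case: (eqVneq i a) ij => [-> | ia] ij.
  by rewrite eq_sym (negbTE ij) wf // in_setD1 eq_sym ij.
case: (eqVneq j a) => [_ | ja]; first by rewrite esym wf // in_setD1 ia.
by apply: fe; rewrite ?in_setD1 ?ia ?ja.
Qed.

(** The value [g a] lies in [P a] or in [P b]; the other of the two blocks is served by [y] or [w],
    which has no neighbour among the values of [g] on [L :\ b]. *)
Lemma indep_transversal_merge (T K : finType) (e : rel T) (P : K -> {set T})
    (L : {set K}) (a b : K) (w y : T) (g : K -> T) :
  symmetric e -> a \in L -> b != a -> w \in P a -> y \in P b ->
  indep_transversal e (merge_blocks e P a b w y) (L :\ b) g ->
  exists f, indep_transversal e P L f.
Proof.
move=> esym aL ba wa yb [gP ge].
have ga : a \in L :\ b by rewrite in_setD1 eq_sym ba.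
have gN i : i \in L :\ b -> ~~ e w (g i) /\ ~~ e y (g i).
  by move=> iL; move: (gP i iL); rewrite inE => /andP[_ /andP].
have gO i : i \in L :\ b -> i != a -> g i \in P i.
  move=> iL ia; move: (gP i iL); rewrite inE => /andP[+ _].
  by rewrite (negbTE ia); case: eqP iL => // ->; rewrite setD11.
have [gaP | gaP] : g a \in P a \/ g a \in P b.
- by move: (gP a ga); rewrite inE eqxx eq_sym (negbTE ba) in_setU => /andP[/orP].
- exists (fun i => if i == b then y else g i).
  apply: indep_transversal_extend => // [|i /gN[]//].
  split=> // i iL; by case: (eqVneq i a) => [-> // | /gO]; apply.
(* Here [g a] serves block [b] and [w] serves block [a]. *)
exists (fun i => if i == a then w else if i == b then g a else g i).
have memLb i : i \in L :\ a -> i != b -> i \in L :\ b.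
  by rewrite !in_setD1 => /andP[_ ->] ->.
apply: indep_transversal_extend => // [|i iL]; last first.
  case: (eqVneq i b) => [_ | ib]; first by case: (gN a ga).
  by case: (gN i (memLb _ iL ib)).
split=> [i iL | i j iL jL ij].
  case: (eqVneq i b) => [-> // | ib]; apply: gO; first exact: memLb.
  by move: iL; rewrite in_setD1 => /andP[].
have [ia ja] : i != a /\ j != a.
  by move: iL jL; rewrite !in_setD1 => /andP[-> _] /andP[-> _].
case: (eqVneq i b) ij => [-> | ib] ij.
  rewrite eq_sym (negbTE ij); apply: ge => //; last by rewrite eq_sym.
  by apply: memLb; rewrite // eq_sym.
case: (eqVneq j b) => [_ | jb]; first by apply: ge => //; apply: memLb.
by apply: ge => //; apply: memLb.
Qed.

Lemma haxell_deficiency (T K : finType) (e : rel T) (P : K -> {set T})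
    (L : {set K}) (a : K) (f : K -> T) :
  symmetric e -> (forall i j x, x \in P i -> x \in P j -> i = j) ->
  a \in L -> indep_transversal e P (L :\ a) f ->
  (exists g, indep_transversal e P L g) \/
  exists (J : {set K}) (Z : {set T}),
    [/\ J \subset L, a \in J, #|Z| + 2 <= 2 * #|J|
      & totally_dominates e Z (\bigcup_(i in J) P i)].
Proof.
(* Deleting an edge lowers the second summand; merging lowers the first and keeps [e]. *)
have [m] := ubnP (#|L| + #|[set p | e p.1 p.2]|).
elim: m => // m IH in e P L f *.
rewrite ltnS => lem esym Pdisj aL ITf.
have [Pa0 | [w wa]] := set_0Vmem (P a).
  right; exists [set a], set0; rewrite sub1set aL set11 cards0 cards1.
  by split=> // v; rewrite big_set1 Pa0 inE.
case: (boolP [forall i in L :\ a, ~~ e w (f i)]) => [/forall_inP wf | ].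
  left; exists (fun i => if i == a then w else f i).
  exact: indep_transversal_extend.
rewrite negb_forall_in => /exists_inP[b bL]; rewrite negbK => ewy.
have yb : f b \in P b := ITf.1 b bL.
move: (f b) yb ewy => y yb ewy.
move: bL; rewrite in_setD1 => /andP[ba bL].
pose e' := del_edge e w y.
have sube u v : e' u v -> e u v by case/andP.
have esym' : symmetric e'.
  by move=> u v; rewrite /e' /del_edge esym orbC ![(v == _) && _]andbC.
have lt_edges : #|L| + #|[set p | e' p.1 p.2]| < m.
  apply: leq_trans lem; rewrite ltn_add2l; apply/proper_card/properP; split.
    by apply/subsetP => p; rewrite !inE => /sube.
  by exists (w, y); rewrite !inE //= /e' /del_edge !eqxx andbF.
have ITf' : indep_transversal e' P (L :\ a) f.
  case: ITf => fP fe; split=> // i j iL jL ij.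
  exact: contra (@sube _ _) (fe i j iL jL ij).
have [[g ITg] | [J [Z [JL aJ ZJ dom]]]] :=
    IH e' P L f lt_edges esym' Pdisj aL ITf'; last first.
  right; exists J, Z; split=> // v /dom[z zZ /sube]; by exists z.
have [gP ge] := ITg.
(* By disjointness [g] can take the value [w] only at [a] and [y] only at [b], so restoring the edge
   affects no other pair of indices. *)
have gne i j : i \in L -> j \in L -> i != j ->
    ~~ ((i == a) && (j == b) || (i == b) && (j == a)) -> ~~ e (g i) (g j).
  move=> iL jL ij; apply: contra => egij.
  move: (ge i j iL jL ij); rewrite /e' /del_edge egij /= negbK.
  have eqa k : k \in L -> g k == w -> k == a.
    by move=> kL /eqP gk; apply/eqP/(Pdisj _ _ w) => //; rewrite -gk gP.
  have eqb k : k \in L -> g k == y -> k == b.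
    by move=> kL /eqP gk; apply/eqP/(Pdisj _ _ y) => //; rewrite -gk gP.
  by case/orP => /andP[]; [move=> /eqa-> // /eqb-> | move=> /eqb-> // /eqa->];
    rewrite ?orbT.
have [/andP[/eqP gaw /eqP gby] | ngwy] := boolP ((g a == w) && (g b == y));
    last first.
  left; exists g; split=> // i j iL jL ij.
  have gab : ~~ e (g a) (g b).
    move: (ge a b aL bL); rewrite eq_sym ba => /(_ isT); apply: contra => egab.
    rewrite /e' /del_edge egab (negbTE ngwy) /=.
    apply/negP => /andP[/eqP gay _].
    by move: ba; rewrite (Pdisj b a y) ?eqxx // -gay gP.
  have [/orP[]/andP[/eqP-> /eqP->]//|] :=
    boolP ((i == a) && (j == b) || (i == b) && (j == a)); last exact: gne.
  by rewrite esym.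
have aLb : a \in L :\ b by rewrite in_setD1 eq_sym ba.
have lt_blocks : #|L :\ b| + #|[set p | e p.1 p.2]| < m.
  by apply: leq_trans lem; rewrite [X in _ < X + _](cardsD1 b) bL; lia.
pose P' := merge_blocks e P a b w y.
have Pdisj' i j x : x \in P' i -> x \in P' j -> i = j.
  rewrite !inE; case: eqVneq => [_|ib]; first by rewrite inE.
  case: (eqVneq j b) => [_|jb]; first by move=> _; rewrite inE.
  case: eqVneq => [->|ia]; case: eqVneq => [->|ja] //; rewrite ?in_setU.
  - by move=> /andP[/orP[]xi _] /andP[xj _];
      move: ja jb; rewrite (Pdisj _ _ x xj xi) eqxx.
  - by move=> /andP[xi _] /andP[/orP[]xj _];
      move: ia ib; rewrite (Pdisj _ _ x xi xj) eqxx.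
  by move=> /andP[xi _] /andP[xj _]; apply: Pdisj xi xj.
(* Since [g a = w] and [g b = y], the other values of [g] avoid the neighbours of both and survive
   the merging. *)
have ITg' : indep_transversal e P' (L :\ b :\ a) g.
  split=> [i | i j].
    rewrite !in_setD1 => /and3P[ia ib iL]; rewrite inE (negbTE ib) (negbTE ia).
    rewrite gP //= -gaw -gby; apply/andP.
    by split; apply: gne; rewrite // ?(negbTE ia) ?(negbTE ib) ?andbF // eq_sym.
  rewrite !in_setD1 => /and3P[ia ib iL] /and3P[ja jb jL] ij.
  by apply: gne => //; rewrite (negbTE ia) (negbTE ib).
have [[h ITh] | [J [Z [JL aJ ZJ dom]]]] :=
    IH e P' (L :\ b) g lt_blocks esym Pdisj' aLb ITg'.
  by left; apply: indep_transversal_merge ITh.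
(* One more block pays for two more vertices. What [w] and [y] leave undominated in [P b] lies in
   the merged block [a], which is covered because [a \in J]. *)
right; exists (b |: J), (w |: (y |: Z)); split.
- by rewrite subUset sub1set bL; apply: subset_trans JL (subsetDl _ _).
- by rewrite inE aJ orbT.
- have bJ : b \notin J by apply/negP => /(subsetP JL); rewrite setD11.
  rewrite !cardsU1 bJ; move: ZJ.
  by case: (_ \notin _); case: (_ \notin _) => /=; lia.
move=> v /bigcupP[i iJ vi].
have [ewv | nwv] := boolP (e w v); first by exists w; rewrite // !inE eqxx.
have [eyv | nyv] := boolP (e y v); first by exists y; rewrite // !inE eqxx orbT.
have /dom[z zZ ezv] : v \in \bigcup_(i in J) P' i.
  move: iJ; rewrite in_setU1; have [ib _ | ib /= iJ] := eqVneq i b.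
    apply/bigcupP; exists a => //.
    by rewrite inE nwv nyv eq_sym (negbTE ba) eqxx in_setU -ib vi orbT.
  apply/bigcupP; exists i => //; rewrite inE nwv nyv (negbTE ib) !andbT.
  by case: eqP => [ia|//]; rewrite in_setU -ia vi.
by exists z; rewrite // !inE zZ !orbT.
Qed.

Lemma card_totally_dominated (T : finType) (e : rel T) (D : nat)
    (Z A : {set T}) :
  (forall v, #|[set u | e v u]| <= D) -> totally_dominates e Z A ->
  #|A| <= #|Z| * D.
Proof.
move=> deg dom; apply: (@leq_trans #|\bigcup_(z in Z) [set u | e z u]|).
  apply/subset_leq_card/subsetP => v /dom[z zZ ezv].
  by apply/bigcupP; exists z; rewrite ?inE.
rewrite -sum_nat_const; apply: (@leq_trans (\sum_(z in Z) #|[set u | e z u]|)).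
  elim/big_rec2: _ => [|z n B _ le]; first by rewrite cards0.
  by apply: leq_trans (leq_card_setU _ _) _; rewrite leq_add2l.
exact: leq_sum.
Qed.

Theorem haxell_transversal (T K : finType) (e : rel T) (P : K -> {set T}) (D : nat) :
  symmetric e -> (forall v, #|[set u | e v u]| <= D) -> 0 < D ->
  (forall i j x, x \in P i -> x \in P j -> i = j) ->
  (forall i, 2 * D <= #|P i|) ->
  exists f, indep_transversal e P [set: K] f.
Proof.
move=> esym deg D0 Pdisj Psize.
suff /(_ _ _ erefl) H : forall n (L : {set K}), #|L| = n ->
  exists f, indep_transversal e P L f by exact: H.
elim=> [|n IH] L cL.
  (* Even for empty [L] a function on all of [K] is needed; nonempty blocks supply its values. *)
  have Pne i : exists x, x \in P i.
    by apply/card_gt0P; apply: leq_trans (Psize i); rewrite muln_gt0.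
  exists (fun i => xchoose (Pne i)); rewrite (cards0_eq cL).
  by split=> i; rewrite ?inE.
have /card_gt0P[a aL] : 0 < #|L| by rewrite cL.
have [|f ITf] := IH (L :\ a); first by move: (cardsD1 a L); rewrite cL aL => -[].
have [//|[J [Z [_ aJ ZJ dom]]]] := haxell_deficiency esym Pdisj aL ITf.
have := card_totally_dominated deg dom.
(* Disjointness gives this lower bound, while domination gives at most
   [#|Z| * D <= (2 * #|J| - 2) * D], a contradiction as [D > 0]. *)
have : #|J| * (2 * D) <= #|\bigcup_(i in J) P i|.
  rewrite big_mkcond -[X in _ <= X]sum1_card.
  rewrite partition_disjoint_bigcup /=; last first.
    move=> i j ij; apply/pred0P => x /=; apply/negP.
    case: ifP; case: ifP; rewrite ?inE ?andbF // => _ _.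
    by move=> /andP[xi /(Pdisj _ _ _ xi)/eqP]; rewrite (negbTE ij).
  rewrite -sum_nat_const [X in X <= _]big_mkcond; apply: leq_sum => i _.
  by rewrite sum1_card; case: ifP.
nia.
Qed.

(** Runs of [m] consecutive entries of [enum A]: the quotient determines [j], so distinct pieces are
    disjoint. *)
Definition chunk (T : finType) (A : {set T}) (m j : nat) : {set T} :=
  [set x in A | index x (enum A) %/ m == j].

Lemma card_chunk (T : finType) (A : {set T}) (m j : nat) :
  0 < m -> j.+1 * m <= #|A| -> m <= #|chunk A m j|.
Proof.
move=> m0 jm.
have /card_gt0P[x0 _] : 0 < #|A|.
  by apply: leq_trans jm; rewrite muln_gt0.
pose f (k : 'I_m) := nth x0 (enum A) (j * m + k).
have ltA (k : 'I_m) : j * m + k < size (enum A).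
  by rewrite -cardE; apply: leq_trans jm; rewrite mulSn addnC ltn_add2r.
have finj : injective f.
  move=> k l /eqP; rewrite nth_uniq ?enum_uniq // eqn_add2l => /eqP.
  exact: val_inj.
rewrite -[X in X <= _]card_ord -cardsT -(card_imset _ finj).
apply/subset_leq_card/subsetP => _ /imsetP[k _ ->].
rewrite inE -mem_enum mem_nth //= index_uniq ?enum_uniq //.
by rewrite divnMDl // divn_small // addn0.
Qed.

Theorem theorem4p5 (s Delta : nat) (hs : 1 <= s) (hDelta : 1 <= Delta)
    (T : finType) (G : sgraph T) (r : nat) (V : 'I_r -> {set T})
    (hV : multipartite G V) (hdeg : max_degree G <= Delta)
    (hthick : thick V (2 * s ^ 2 * Delta)) :
  exists S : {set T}, transversal_blowup G V s S.
Proof.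
have [_ Vdisj _] := hV.
have Vinj i j x : x \in V i -> x \in V j -> i = j.
  move=> xi xj; apply/eqP/negP => /negP /Vdisj.
  by rewrite disjoint_subset => /subsetP/(_ x xi); rewrite inE xj.
pose P (p : 'I_r * 'I_s) := chunk (V p.1) (2 * Delta) p.2.
have [|v||p q x|[i j]|f [fP fG]] := @haxell_transversal T _ G P Delta.
- exact: adj_sym.
- by apply: leq_trans hdeg; rewrite /max_degree (leq_bigmax v).
- exact: hDelta.
- rewrite !inE => /andP[xp /eqP jp] /andP[xq /eqP jq].
  have eq1 := Vinj _ _ _ xp xq.
  case: p q eq1 jp jq {xp xq} => [i j] [i' j'] /= -> -> jj'.
  by congr pair; apply: val_inj.
(* Piece [j] fits into [V i] because [j.+1 <= s <= s ^ 2]. *)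
- apply: card_chunk; first by rewrite muln_gt0.
  apply: leq_trans (hthick i); rewrite mulnCA mulnA leq_pmul2r // leq_pmul2l //.
  by rewrite (leq_trans (ltn_ord j)) // leq_pmulr.
have fV p : f p \in V p.1.
  by have := fP p (in_setT p); rewrite inE => /andP[].
(* A vertex determines its block and its piece, hence the index [p]; so block [i] receives exactly
   [s] distinct vertices. *)
have finj : injective f.
  move=> p q fpq; have := fP p (in_setT p); have := fP q (in_setT q).
  rewrite fpq !inE => /andP[xq /eqP jq] /andP[xp /eqP jp].
  have eq1 := Vinj _ _ _ xp xq.
  case: p q eq1 jp jq {xp xq fpq} => [i j] [i' j'] /= -> -> jj'.
  by congr pair; apply: val_inj.
exists (f @: setT); split=> [_ _ /imsetP[p _ ->] /imsetP[q _ ->] | i].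
  by have [-> | pq] := eqVneq p q; [rewrite adj_irr | apply: fG].
have -> : f @: setT :&: V i = [set f (i, j) | j : 'I_s].
  apply/setP => x; rewrite in_setI.
  apply/andP/imsetP => [[/imsetP[p _ ->] fi] | [j _ ->]].
    by exists p.2; rewrite // -(Vinj _ _ _ (fV p) fi) -surjective_pairing.
  by split; [apply: imset_f | apply: (fV (i, j))].
rewrite card_imset ?card_ord // => j j' /finj; by case.
Qed.
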